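(* Let $\mathbf{N}\subset\mathbb{R}^d$ be a network (a connected finite union of two or more distinct homoclinic/heteroclinic cycles) of the flow $\phi_t$, and let $\mathbf{q}$ be a sequence on $\mathbf{N}$. Suppose $\mathbf{q}$ is aperiodic and fragmentarily asymptotically stable (f.a.s.). Then there are countably infinitely many aperiodic sequences on $\mathbf{N}$ that are f.a.s.
   Context: Setting. $\dot x=f(x)$ is a differential equation on $\mathbb{R}^d$ inducing a sufficiently smooth flow $\phi_t$; $\mu$ is Lebesgue measure on $\mathbb{R}^d$; $\mathbb{N}=\{1,2,3,\dots\}$; $\mathrm{d}(A,x)=\inf_{y\in A}\|x-y\|$; $W^{\mathrm u}(\xi),W^{\mathrm s}(\xi)$ are the unstable/stable manifolds of a hyperbolic equilibrium $\xi$. Networks. A cycle of length $L\ge 1$ consists of distinct hyperbolic equilibria $\xi_1,\dots,\xi_L$ and connecting trajectories $\gamma_l\subset W^{\mathrm u}(\xi_l)\cap W^{\mathrm s}(\xi_{l+1})$ (indices modulo $L$), and is identified with the invariant set $\bigcup_{l}(\{\xi_l\}\cup\gamma_l)$. It is homoclinic if $L=1$ and heteroclinic if $L>1$. A network $\mathbf{N}$ is a connected finite union of two or more distinct cycles, possibly of different lengths; it has equilibria $\xi_1,\dots,\xi_P$ and connecting trajectories $\gamma_1,\dots,\gamma_Q$, so $\mathbf{N}=\bigcup_{p=1}^P\{\xi_p\}\cup\bigcup_{q=1}^Q\gamma_q$. Write $\alpha[\gamma_q]$, $\omega[\gamma_q]$ for the equilibria that are the $\alpha$- and $\omega$-limit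 of the points of $\gamma_q$. Sequences. A sequence on $\mathbf{N}$ is an infinite sequence $\mathbf{q}=q_1q_2q_3\dots$ with $q_k\in\{1,\dots,Q\}$ and $\omega[\gamma_{q_k}]=\alpha[\gamma_{q_{k+1}}]$ for all $k\in\mathbb{N}$. It is preperiodic if there are $K>0$ and $K_0\ge0$ with $q_{k+K}=q_k$ for all $k>K_0$, and aperiodic if it is not preperiodic. The shift is $\Sigma(q_1q_2q_3\dots)=q_2q_3q_4\dots$. Following a sequence. Let $U_p$ be a neighborhood of $\xi_p$ for each $p$ (also written $U_{\xi_p}$), and let $V_q$ be a neighborhood of a chosen point $\zeta_q\in\gamma_q$ for each $q$, where all the $U_p,V_q$ are disjoint; these are fixed. Let $U_{\mathbf N}$ be a neighborhood of $\mathbf{N}$. A trajectory $x(t)=\phi_t(x)$ follows $\mathbf{q}$ within $U_{\mathbf{N}}$ if there are two monotonically increasing sequences of non-negative times $t_k,t'_k$ ($k\in\mathbb{N}$) such that for all $k\in\mathbb{N}$: $t_k<t'_k<t_{k+1}$, and (i) $x(t)\in U_{\mathbf{N}}$ for all $t>t_1$; (ii) $x(t_k)\in U_{\alpha[\gamma_{q_k}]}$ and $x(t'_k)\in V_{q_k}$; (iii) for all $t\in(t'_k,t'_{k+1})$, $x(t)\notin U_{p'}$ whenever $\xi_{p'}\ne\omega[\gamma_{q_k}]$. Stability. For $\delta>0$ let $B_\delta(\mathbf{N})$ be the $\delta$-neighborhood of $\mathbf{N}$. Define $\mathcal{S}_\delta(\mathbf{q})=\{x\in B_\delta(\mathbf{N})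 : \phi_t(x)\text{ follows }\mathbf{q}\text{ within }U_{\mathbf{N}}=B_\delta(\mathbf{N})\}$, $\mathcal{A}_\delta(\mathbf{q})=\{x\in\mathcal{S}_\delta(\mathbf{q}) : \lim_{t\to\infty}\mathrm{d}(\mathbf{N},\phi_t(x))=0\}$, $\mathcal{B}_\delta(\mathbf{q})=\bigcup_{k\in\mathbb{N}}\mathcal{A}_\delta(\Sigma^k\mathbf{q})$. The sequence $\mathbf{q}$ is fragmentarily asymptotically stable (f.a.s.) if $\mu(\mathcal{B}_\delta(\mathbf{q}))>0$ for every $\delta>0$. *)

(* Defs.v *)
From HB Require Import structures.
From mathcomp Require Import all_boot all_order all_algebra.
From mathcomp Require Import complex.
From mathcomp Require Import all_classical all_reals all_analysis.

Set Implicit Arguments.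
Unset Strict Implicit.
Unset Printing Implicit Defensive.
Import Order.TTheory GRing.Theory Num.Theory.
Import numFieldNormedType.Exports.
Local Open Scope classical_set_scope.
Local Open Scope ring_scope.

(* The topology of 'rV[R]_d is that of R^d, but its library norm is the sup
   norm; metric notions below use the Euclidean norm instead. *)
Definition enorm (R : realType) d (x : 'rV[R]_d) : R :=
  Num.sqrt (\sum_i x 0 i ^+ 2).

Definition dist (R : realType) d (A : set 'rV[R]_d) (x : 'rV[R]_d) : R :=
  inf [set enorm (x - y) | y in A].

Definition dball (R : realType) d (delta : R) (A : set 'rV[R]_d) :
    set 'rV[R]_d :=
  [set x | dist A x < delta].

(* Lebesgue measure on R^d, as the infimum of the total volume of countable
   covers by half-open boxes.  It is defined on all sets (as the Lebesgue outer
   measure) and is the Lebesgue measure on the Lebesgue measurable ones. *)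
Definition box (R : realType) d (a b : 'rV[R]_d) : set 'rV[R]_d :=
  [set x | forall i, a 0 i < x 0 i <= b 0 i].

Definition box_volume (R : realType) d (a b : 'rV[R]_d) : R :=
  \prod_i (b 0 i - a 0 i).

Definition box_cover (R : realType) d (A : set 'rV[R]_d) :
    set (nat -> 'rV[R]_d * 'rV[R]_d) :=
  [set c : nat -> 'rV[R]_d * 'rV[R]_d | (forall k i, (c k).1 0 i <= (c k).2 0 i) /\
           A `<=` \bigcup_k box (c k).1 (c k).2].

Definition lebesgue_rV (R : realType) d (A : set 'rV[R]_d) : \bar R :=
  ereal_inf [set (\sum_(k <oo) (box_volume (c k).1 (c k).2)%:E)%E |
             c in box_cover A].

(* In finite dimension, continuity of x |-> 'd g x v for each v is continuity
   of the differential. *)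
Definition C1 (R : realType) (V W : normedModType R) (g : V -> W) : Prop :=
  (forall x, differentiable g x) /\ (forall v, continuous (fun x => 'd g x v)).

Record is_flow (R : realType) d (f : 'rV[R]_d -> 'rV[R]_d)
    (phi : R -> 'rV[R]_d -> 'rV[R]_d) : Prop := IsFlow {
  flow_field : C1 f ;
  flow_smooth : C1 (fun z : R^o * 'rV[R]_d => phi z.1 z.2) ;
  flow0 : forall x, phi 0 x = x ;
  flowD : forall s t x, phi (s + t) x = phi s (phi t x) ;
  flow_ode : forall (x : 'rV[R]_d) (t : R),
    is_derive (t : R^o) (1 : R^o) (fun s : R^o => phi s x) (f (phi t x)) }.

Definition hyperbolic_equilibrium (R : realType) d
    (f : 'rV[R]_d -> 'rV[R]_d) (p : 'rV[R]_d) : Prop :=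
  f p = 0 /\
  forall z : R[i],
    eigenvalue (map_mx (real_complex R) (jacobian f p)) z -> complex.Re z != 0.

Definition unstable_manifold (R : realType) d
    (phi : R -> 'rV[R]_d -> 'rV[R]_d) (p : 'rV[R]_d) : set 'rV[R]_d :=
  [set x | phi t x @[t --> -oo] --> p].

Definition stable_manifold (R : realType) d
    (phi : R -> 'rV[R]_d -> 'rV[R]_d) (p : 'rV[R]_d) : set 'rV[R]_d :=
  [set x | phi t x @[t --> +oo] --> p].

(* The condition f x <> 0 only matters for p = p', where it excludes the
   constant trajectory {p}. *)
Definition connecting_trajectory (R : realType) d
    (f : 'rV[R]_d -> 'rV[R]_d) (phi : R -> 'rV[R]_d -> 'rV[R]_d)
    (p p' : 'rV[R]_d) (g : set 'rV[R]_d) : Prop :=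
  (exists2 x, f x <> 0 & g = range (phi ^~ x)) /\
  g `<=` unstable_manifold phi p `&` stable_manifold phi p'.

Record cycle (R : realType) (d : nat) := Cycle {
  cycle_len : nat ;
  cycle_eq : 'I_cycle_len -> 'rV[R]_d ;
  cycle_traj : 'I_cycle_len -> set 'rV[R]_d }.

(* ordS is the successor modulo the length. *)
Definition is_cycle (R : realType) d
    (f : 'rV[R]_d -> 'rV[R]_d) (phi : R -> 'rV[R]_d -> 'rV[R]_d)
    (C : cycle R d) : Prop :=
  [/\ (0 < cycle_len C)%N,
      injective (@cycle_eq R d C),
      forall l, hyperbolic_equilibrium f (@cycle_eq R d C l) &
      forall l, connecting_trajectory f phi
        (@cycle_eq R d C l) (@cycle_eq R d C (ordS l)) (@cycle_traj R d C l)].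

Definition cycle_set (R : realType) d (C : cycle R d) : set 'rV[R]_d :=
  \bigcup_l ([set @cycle_eq R d C l] `|` @cycle_traj R d C l).

Definition network_set (R : realType) d P Q
    (xi : 'I_P -> 'rV[R]_d) (gam : 'I_Q -> set 'rV[R]_d) : set 'rV[R]_d :=
  (\bigcup_p [set xi p]) `|` (\bigcup_q gam q).

(* xi and gam enumerate, without repetition, the equilibria and the connecting
   trajectories of the cycles C i; distinct cycles are distinct as sets. *)
Definition is_network (R : realType) d
    (f : 'rV[R]_d -> 'rV[R]_d) (phi : R -> 'rV[R]_d -> 'rV[R]_d) P Q
    (xi : 'I_P -> 'rV[R]_d) (gam : 'I_Q -> set 'rV[R]_d) : Prop :=
  [/\ injective xi, injective gam, connected (network_set xi gam) &
      exists (m : nat) (C : 'I_m -> cycle R d),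
        [/\ (2 <= m)%N,
            forall i, is_cycle f phi (C i),
            injective (fun i => cycle_set (C i)),
            range xi = \bigcup_i range (@cycle_eq R d (C i)) &
            range gam = \bigcup_i range (@cycle_traj R d (C i))]].

Definition alpha_limit (R : realType) d
    (phi : R -> 'rV[R]_d -> 'rV[R]_d) (g : set 'rV[R]_d) : 'rV[R]_d :=
  get [set a | forall x, g x -> phi t x @[t --> -oo] --> a].

Definition omega_limit (R : realType) d
    (phi : R -> 'rV[R]_d -> 'rV[R]_d) (g : set 'rV[R]_d) : 'rV[R]_d :=
  get [set a | forall x, g x -> phi t x @[t --> +oo] --> a].

(* Sequences are indexed from 0: q 0, q 1, ... stand for q_1, q_2, ... *)
Definition sequence_on (R : realType) d
    (phi : R -> 'rV[R]_d -> 'rV[R]_d) Q (gam : 'I_Q -> set 'rV[R]_d)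
    (q : nat -> 'I_Q) : Prop :=
  forall k, omega_limit phi (gam (q k)) = alpha_limit phi (gam (q k.+1)).

Definition preperiodic (T : Type) (q : nat -> T) : Prop :=
  exists K K0 : nat, (0 < K)%N /\ forall k, (K0 <= k)%N -> q (k + K)%N = q k.

Definition aperiodic (T : Type) (q : nat -> T) : Prop := ~ preperiodic q.

Definition shift (T : Type) (q : nat -> T) : nat -> T := fun k => q k.+1.

Definition is_neighborhoods (R : realType) d P Q
    (xi : 'I_P -> 'rV[R]_d) (gam : 'I_Q -> set 'rV[R]_d)
    (U : 'I_P -> set 'rV[R]_d) (V : 'I_Q -> set 'rV[R]_d)
    (zeta : 'I_Q -> 'rV[R]_d) : Prop :=
  [/\ (forall p, nbhs (xi p) (U p)) /\
      (forall q, gam q (zeta q) /\ nbhs (zeta q) (V q)),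
      trivIset setT U, trivIset setT V & forall p q, U p `&` V q = set0].

Definition follows (R : realType) d
    (phi : R -> 'rV[R]_d -> 'rV[R]_d) P Q
    (xi : 'I_P -> 'rV[R]_d) (gam : 'I_Q -> set 'rV[R]_d)
    (U : 'I_P -> set 'rV[R]_d) (V : 'I_Q -> set 'rV[R]_d)
    (UN : set 'rV[R]_d) (q : nat -> 'I_Q) (x : 'rV[R]_d) : Prop :=
  exists t t' : nat -> R,
    [/\ (forall k, 0 <= t k /\ 0 <= t' k) /\
        (increasing_seq t /\ increasing_seq t'),
        forall k, t k < t' k < t k.+1,
        forall s, t 0%N < s -> UN (phi s x),
        forall k,
          (exists2 p, xi p = alpha_limit phi (gam (q k)) &
                      U p (phi (t k) x)) /\
          V (q k) (phi (t' k) x) &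
        forall k s, t' k < s < t' k.+1 ->
          forall p, xi p <> omega_limit phi (gam (q k)) -> ~ U p (phi s x)].

Definition S_delta (R : realType) d
    (phi : R -> 'rV[R]_d -> 'rV[R]_d) P Q
    (xi : 'I_P -> 'rV[R]_d) (gam : 'I_Q -> set 'rV[R]_d)
    (U : 'I_P -> set 'rV[R]_d) (V : 'I_Q -> set 'rV[R]_d)
    (delta : R) (q : nat -> 'I_Q) : set 'rV[R]_d :=
  let BN := dball delta (network_set xi gam) in
  [set x | BN x /\ follows phi xi gam U V BN q x].

Definition A_delta (R : realType) d
    (phi : R -> 'rV[R]_d -> 'rV[R]_d) P Q
    (xi : 'I_P -> 'rV[R]_d) (gam : 'I_Q -> set 'rV[R]_d)
    (U : 'I_P -> set 'rV[R]_d) (V : 'I_Q -> set 'rV[R]_d)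
    (delta : R) (q : nat -> 'I_Q) : set 'rV[R]_d :=
  [set x | S_delta phi xi gam U V delta q x /\
           dist (network_set xi gam) (phi t x) @[t --> +oo] --> (0 : R)].

(* The union runs over k >= 1. *)
Definition B_delta (R : realType) d
    (phi : R -> 'rV[R]_d -> 'rV[R]_d) P Q
    (xi : 'I_P -> 'rV[R]_d) (gam : 'I_Q -> set 'rV[R]_d)
    (U : 'I_P -> set 'rV[R]_d) (V : 'I_Q -> set 'rV[R]_d)
    (delta : R) (q : nat -> 'I_Q) : set 'rV[R]_d :=
  \bigcup_(k in [set k : nat | (1 <= k)%N])
    A_delta phi xi gam U V delta (iter k (@shift 'I_Q) q).

Definition fas (R : realType) d
    (phi : R -> 'rV[R]_d -> 'rV[R]_d) P Q
    (xi : 'I_P -> 'rV[R]_d) (gam : 'I_Q -> set 'rV[R]_d)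
    (U : 'I_P -> set 'rV[R]_d) (V : 'I_Q -> set 'rV[R]_d)
    (q : nat -> 'I_Q) : Prop :=
  forall delta : R, 0 < delta ->
    (0 < lebesgue_rV (B_delta phi xi gam U V delta q))%E.

(* Main.v *)
(** If a trajectory follows [q], then dropping the first pair of times shows that
    it follows the shift of [q].  Hence the sets [A_delta] increase along the
    shifts of [q], so every shift of an f.a.s. sequence is f.a.s.; the shifts of
    an aperiodic sequence are aperiodic and pairwise distinct. *)
Require Import Defs.
From mathcomp Require Import all_boot all_order all_algebra.
From mathcomp Require Import all_classical all_reals all_analysis.
Import Order.POrderTheory numFieldNormedType.Exports.
Local Open Scope classical_set_scope.
Local Open Scope ring_scope.

Lemma iter_shiftE {T : Type} (q : nat -> T) (n k : nat) :
  iter n (@Defs.shift T) q k = q (k + n)%N.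
Proof. by elim: n k => [|n IHn] k; rewrite ?addn0 //= /Defs.shift IHn addnS. Qed.

(** A period of the [n]-th shift valid from [K0] on is a period of [q] valid from [K0 + n] on. *)
Lemma aperiodic_iter_shift {T : Type} (q : nat -> T) (n : nat) :
  aperiodic q -> aperiodic (iter n (@Defs.shift T) q).
Proof.
move=> qA [K [K0 [K_gt0 qK]]]; apply: qA; exists K, (K0 + n)%N.
(* The truncated difference [k - n] is a true one, since [n <= K0 + n <= k]. *)
split=> // k le_k; have := qK (k - n)%N.
rewrite !iter_shiftE addnAC subnK ?(leq_trans (leq_addl _ _) le_k) //.
by apply; rewrite leq_subRL ?(leq_trans (leq_addl _ _) le_k) // addnC.
Qed.

(** If the [m]-th and [n]-th shifts agree with [m < n], then [q] has period [n - m] from [m] on: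
    compare them at [k - m]. *)
Lemma aperiodic_iter_shift_inj {T : Type} (q : nat -> T) :
  aperiodic q -> injective (fun n => iter n (@Defs.shift T) q).
Proof.
move=> qA m n.
wlog lt_mn : m n / (m < n)%N => [wlt eq_mn|eq_mn].
  by case: (ltngtP m n) => // lt; [|symmetry]; apply: wlt.
case: qA; exists (n - m)%N, m; rewrite subn_gt0; split=> // k le_mk.
have := congr1 (fun r => r (k - m)%N) eq_mn.
rewrite !iter_shiftE subnK // => ->.
by rewrite addnBA ?(ltnW lt_mn) // addnBAC.
Qed.

(** Every box cover of [B] also covers [A], so the infimum for [A] runs over more covers. *)
Lemma le_lebesgue_rV {R : realType} {d : nat} (A B : set 'rV[R]_d) :
  A `<=` B -> (lebesgue_rV A <= lebesgue_rV B)%E.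
Proof.
move=> sAB; apply: ereal_inf_le_tmp; apply: image_subset => c [cle cB].
by split=> //; apply: subset_trans cB.
Qed.

Section Following.
Context {R : realType} {d : nat} {phi : R -> 'rV[R]_d -> 'rV[R]_d} {P Q : nat}.
Context {xi : 'I_P -> 'rV[R]_d} {gam : 'I_Q -> set 'rV[R]_d}.
Context {U : 'I_P -> set 'rV[R]_d} {V : 'I_Q -> set 'rV[R]_d}.

Lemma follows_shift (UN : set 'rV[R]_d) (q : nat -> 'I_Q) (x : 'rV[R]_d) :
  follows phi xi gam U V UN q x -> follows phi xi gam U V UN (Defs.shift q) x.
Proof.
move=> [t [t' [[tge0 [tI t'I]] tt' inUN visits avoids]]].
exists (fun k => t k.+1), (fun k => t' k.+1); split=> //.
- by do !split; try exact: (tge0 _.+1).1; try exact: (tge0 _.+1).2;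
    move=> m n; rewrite ?tI ?t'I.
(* The new starting time is [t 1], and [t 0 < t' 0 < t 1]. *)
- move=> s ts; apply: inUN; apply: lt_trans ts.
  by have /andP[] := tt' 0%N; apply: lt_trans.
- by move=> k; apply: visits.
- by move=> k; apply: avoids.
Qed.

Lemma A_delta_shift (delta : R) (q : nat -> 'I_Q) :
  A_delta phi xi gam U V delta q `<=` A_delta phi xi gam U V delta (Defs.shift q).
Proof. by move=> x [[xB /follows_shift xq] xN]. Qed.

Lemma fas_shift (q : nat -> 'I_Q) :
  fas phi xi gam U V q -> fas phi xi gam U V (Defs.shift q).
Proof.
move=> qS delta delta_gt0.
apply: lt_le_trans (qS _ delta_gt0) (le_lebesgue_rV _ _ _).
(* The index [k >= 1] is kept: the [k]-th shift of [shift q] is the shift of the [k]-th shift of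
   [q], so [A_delta_shift] applies term by term. *)
by move=> x [k k_gt0 /A_delta_shift xA]; exists k; rewrite // -iterSr.
Qed.

End Following.

Theorem proposition4p1 (R : realType) (d : nat)
    (f : 'rV[R]_d -> 'rV[R]_d) (phi : R -> 'rV[R]_d -> 'rV[R]_d)
    (P Q : nat) (xi : 'I_P -> 'rV[R]_d) (gam : 'I_Q -> set 'rV[R]_d)
    (U : 'I_P -> set 'rV[R]_d) (V : 'I_Q -> set 'rV[R]_d)
    (zeta : 'I_Q -> 'rV[R]_d) (q : nat -> 'I_Q) :
  is_flow f phi ->
  is_network f phi xi gam ->
  is_neighborhoods xi gam U V zeta ->
  sequence_on phi gam q ->
  aperiodic q ->
  fas phi xi gam U V q ->
  exists A : set (nat -> 'I_Q),
    [/\ countable A,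
        infinite_set A &
        forall q', A q' ->
          [/\ sequence_on phi gam q', aperiodic q' & fas phi xi gam U V q']].
Proof.
(* The witness is the set of all iterated shifts of [q], with [q] itself at [n = 0]. *)
move=> _ _ _ qN qA qS; exists (range (fun n => iter n (@Defs.shift 'I_Q) q)); split.
- exact: card_image_le.
- move=> finA; apply: infinite_nat.
  (* [nat] is the preimage of the range under an injective map, so a finite range would make [nat]
     finite. *)
  rewrite -(preimage_range (fun n => iter n (@Defs.shift 'I_Q) q)).
  by apply: finite_preimage finA => m n _ _; apply: aperiodic_iter_shift_inj.
- move=> _ [n _ <-]; split.
  + by move=> k; rewrite !iter_shiftE; apply: qN.
  + exact: aperiodic_iter_shift.
  + by elim: n => [|n IHn] //=; apply: fas_shift.
Qed.
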